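(* Let $p$ be a Sophie Germain prime with $p\equiv 3$ or $5 \pmod 8$, and let $k\geq 0$ be an integer. Then the only non-negative integer solutions of the equation $p^x+(2^{2k+1}(2p+1))^y=z^2$ are $(p,x,y,z)=(3,1,0,2)$ (for any $k$) and $(p,k,x,y,z)=(3,2,0,1,15)$.
   Context: A prime $p$ is called a Sophie Germain prime if $2p+1$ is also prime. *)

(* Defs.v *)
From mathcomp Require Import all_boot.

Set Implicit Arguments.
Unset Strict Implicit.
Unset Printing Implicit Defensive.

Definition sophie_germain (p : nat) : bool := prime p && prime (2 * p + 1).

(* Main.v *)
Require Import Defs.
From mathcomp Require Import all_boot zify.

(** If [y] is odd and [x > 0], reducing modulo [p] (where [2p + 1 = 1]) exhibits 2
as a square modulo [p], impossible for [p = 3, 5] modulo 8.  If [y = 2j], put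
[w = (2^(2k+1) (2p+1))^j]; then [(z - w) (z + w) = p^x] with coprime factors
gives [p^x = 2w + 1], and modulo 8 the exponent [x] is even when [j > 0], up to
one small exception.  This case and the case [x = 0] with [y] odd both reduce to
[b (b + 1) = 2^M (2p+1)^n], where coprimality of [b] and [b + 1] makes
[(2p+1)^n] a neighbour of the power of two [2^M], whence [n = 1]. *)

(** * Parity, and the non-residue 2 *)

Lemma odd_doubleS (n : nat) : odd n -> exists d, n = d.*2.+1.
Proof. by move=> odd_n; exists n./2; rewrite -[LHS]odd_double_half odd_n. Qed.

Lemma even_doubleE (n : nat) : ~~ odd n -> exists d, n = d.*2.
Proof. by move=> /negPf even_n; exists n./2; rewrite -[LHS]odd_double_half even_n. Qed.

Lemma modn_sub_sqr (m r : nat) : r <= m -> (m - r) ^ 2 = r ^ 2 %[mod m].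
Proof.
(* Adding [2rm] to both sides clears the truncated subtraction. *)
move=> le_rm; apply/eqP; rewrite -(eqn_modDl (r.*2 * m)).
have -> : r.*2 * m + (m - r) ^ 2 = m * m + r ^ 2 by rewrite -!mulnn; nia.
by rewrite !modnMDl.
Qed.

(* Descent: for odd [a < m], the cofactor of [m] in [a^2 - 2] is smaller than [m]
   and again congruent to 3 or 5 modulo 8. *)
Lemma two_nonresidue (m a : nat) :
  m %% 8 = 3 \/ m %% 8 = 5 -> a ^ 2 = 2 %[mod m] -> False.
Proof.
elim/ltn_ind: m a => m IH a hm ha.
(* As [m] is odd, one of the two roots [a %% m] and [m - a %% m] is odd. *)
have [b [lt_b odd_b hb]] : exists b, [/\ b < m, odd b & b ^ 2 = 2 %[mod m]].
  have lt_r : a %% m < m by rewrite ltn_pmod; lia.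
  have hr : (a %% m) ^ 2 = 2 %[mod m] by rewrite modnXm.
  case odd_r: (odd (a %% m)); first by exists (a %% m).
  exists (m - a %% m); split; first 1 last.
  - have odd_m : odd m by move: hm; clear; lia.
    by rewrite oddB ?odd_r ?odd_m // ltnW.
  - by rewrite modn_sub_sqr // ltnW.
  - case: (posnP (a %% m)) => [r0|]; last by move: lt_r; clear; lia.
    by move: hr; rewrite r0 exp0n // mod0n modn_small; move: hm; clear; lia.
have b1 : b != 1.
  apply/eqP => b1; move: hb; rewrite b1 exp1n => /eqP.
  by rewrite eq_sym eqn_mod_dvd // subn1 /= dvdn1; move: hm; clear; lia.
have b_gt1 : 1 < b by case: b b1 odd_b {lt_b hb } => [|[]].
have le2_bb : 2 <= b ^ 2 by rewrite -mulnn; move: b_gt1; clear; nia.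
have : m %| b ^ 2 - 2 by rewrite -eqn_mod_dvd ?hb.
case/dvdnP=> c hc.
have {}hc : b * b = c * m + 2 by rewrite -hc mulnn subnK.
have lt_c : c < m by move: hc lt_b; clear; nia.
apply: (IH c lt_c b); last by rewrite -mulnn hc mulnC modnMDl.
(* An odd square is 1 modulo 8, so [c * m] is 7 modulo 8: residues 3 and 5 are swapped between [m]
   and [c]. *)
have : (c * m + 2) %% 8 = 1.
  rewrite -hc; have [d ->] := odd_doubleS _ odd_b.
  have [e he] : exists e, d * d.+1 = e.*2 by apply: even_doubleE; rewrite oddM /= andbN.
  have -> : d.*2.+1 * d.*2.+1 = e * 8 + 1 by move: he; clear; nia.
  by rewrite modnMDl.
rewrite -modnDml -modnMm.
have : c %% 8 < 8 by rewrite ltn_pmod.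
by case: hm => ->; case: (c %% 8) => [|[|[|[|[|[|[|[|u]]]]]]]] //; auto.
Qed.

(** * Odd powers adjacent to powers of two *)

Lemma odd_dvd_exp2 (s m : nat) : odd s -> s %| 2 ^ m -> s = 1.
Proof.
move=> odd_s /(dvdn_pfactor _ _ (isT : prime 2)) [[|n] _ hs] //.
by move: odd_s; rewrite hs oddX.
Qed.

(** The cofactor is the alternating sum [q^(2t) - q^(2t-1) + ... + 1], with an odd number of odd
    terms. *)
Lemma odd_exp_succ_factor (q t : nat) : odd q ->
  exists2 s, odd s & q ^ t.*2.+1 + 1 = (q + 1) * s.
Proof.
move=> odd_q; elim: t => [|t [s odd_s hs]]; first by exists 1; rewrite ?muln1.
have s0 : 0 < s by case: s odd_s {hs}.
(* From [q^(2t+3) + 1 = q^2 (q^(2t+1) + 1) - (q - 1)(q + 1)]. *)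
exists (q * q * s - (q - 1)).
  by rewrite oddB; [rewrite !oddM odd_q odd_s oddB ?odd_q //; lia | nia].
rewrite doubleS 2!expnS; move: (q ^ _) hs => u hs.
have q0 : 0 < q by case: q odd_q {hs}.
have le_q : q - 1 <= q * q * s by move: q0 s0; clear; nia.
have hr : q * q * s - (q - 1) + q = q * q * s + 1 by move: q0 le_q; clear; lia.
move: (q * q * s - (q - 1)) hr => r hr.
have {}hs := congr1 (muln (q * q)) hs.
have {}hr := congr1 (muln (q + 1)) hr.
by move: hs hr; clear; rewrite /=; lia.
Qed.

Lemma odd_exp_pred_factor (q t : nat) : odd q ->
  exists2 s, odd s & q ^ t.*2.+1 - 1 = (q - 1) * s.
Proof.
move=> odd_q; elim: t => [|t [s odd_s hs]]; first by exists 1; rewrite ?muln1.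
have q0 : 0 < q by case: q odd_q {hs}.
exists (q * q * s + (q + 1)).
  by rewrite oddD !oddM odd_q odd_s oddD odd_q.
have u0 : 0 < q ^ t.*2.+1 by rewrite expn_gt0 q0.
rewrite doubleS 2!expnS; move: (q ^ _) hs u0 => u hs u0.
have -> : u = (q - 1) * s + 1 by rewrite -hs subnK.
rewrite -(subnK q0); move: (q - 1) => r; rewrite !addnK.
apply/eqP; rewrite -(eqn_add2r 1) subnK; last by rewrite !muln_gt0 !addn1.
by apply/eqP; clear; lia.
Qed.

(** For odd [n] the odd cofactor of [q + 1] divides [2^m], hence is 1. For even [n], [q^n + 1] is 2
    modulo 4 and exceeds 2, so it is no power of two. *)
Lemma exp_succ_eq_exp2 (q n m : nat) :
  odd q -> 1 < q -> 0 < n -> q ^ n + 1 = 2 ^ m -> n = 1.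
Proof.
move=> odd_q q1 n0 h; case odd_n: (odd n).
  have [t hn] := odd_doubleS _ odd_n.
  have [s odd_s hs] := odd_exp_succ_factor _ t odd_q.
  have s1 : s = 1.
    by apply: (@odd_dvd_exp2 _ m odd_s); rewrite -h hn hs dvdn_mull.
  apply/eqP; rewrite -(eqn_exp2l _ _ q1) expn1; apply/eqP.
  by rewrite hn; lia.
have [t hn] := even_doubleE _ (negbT odd_n).
have [d hd] : exists d, q ^ t = d.*2.+1.
  by apply: odd_doubleS; rewrite oddX odd_q orbT.
have lt_qn : q <= q ^ n by rewrite -{1}(expn1 q) leq_exp2l.
move: h; rewrite {1}hn -muln2 expnM hd -mulnn.
case: m => [|[|m]]; rewrite ?expn0 ?expn1 ?expnS.
- by lia.
- by move: lt_qn; rewrite hn -muln2 expnM hd -mulnn; lia.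
- by move: (2 ^ m) => u; nia.
Qed.

(** Odd [n] is treated with the cofactor of [q - 1]. The bound [3 < q] excludes [3^2 = 2^3 + 1]. *)
Lemma exp_eq_exp2_succ (q n m : nat) :
  odd q -> 3 < q -> 0 < n -> q ^ n = 2 ^ m + 1 -> n = 1.
Proof.
move=> odd_q q3 n0 h; case odd_n: (odd n).
  have [t hn] := odd_doubleS _ odd_n.
  have [s odd_s hs] := odd_exp_pred_factor _ t odd_q.
  have s1 : s = 1.
    apply: (@odd_dvd_exp2 _ m odd_s).
    by rewrite -[2 ^ m](addnK 1) -h hn hs dvdn_mull.
  apply/eqP; rewrite -(eqn_exp2l _ _ (ltn_trans _ q3)) // expn1; apply/eqP.
  have : 0 < q ^ t.*2.+1 by rewrite expn_gt0; lia.
  by rewrite hn; lia.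
have [t hn] := even_doubleE _ (negbT odd_n).
have [d hd] : exists d, q ^ t = d.*2.+1.
  by apply: odd_doubleS; rewrite oddX odd_q orbT.
have : q <= q ^ t by rewrite -{1}(expn1 q) leq_exp2l; lia.
(* Whichever of [d], [d + 1] is odd must be 1, so [q^t] would be 3 or 1. *)
have hm : 2 ^ m = d * d.+1 * 4.
  by move: h; rewrite hn -muln2 expnM hd -mulnn; nia.
rewrite hd => le_q; case odd_d: (odd d).
  have : d = 1.
    by apply: (@odd_dvd_exp2 _ m); rewrite // hm -mulnA dvdn_mulr.
  by lia.
have : d.+1 = 1.
  apply: (@odd_dvd_exp2 _ m); first by rewrite /= odd_d.
  by rewrite hm mulnAC dvdn_mull.
by lia.
Qed.

(** By coprimality [q^n] divides [b] or [b + 1] entirely. The quotient [c] and the other factor then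
    multiply to [2^m]; an even [c] would force that other factor to be odd, hence 1, which is too
    small. *)
Lemma consecutive_mul_exp2_prime (b m q n : nat) :
  prime q -> odd q -> 0 < n -> b * b.+1 = 2 ^ m * q ^ n ->
  b = q ^ n /\ b.+1 = 2 ^ m \/ b = 2 ^ m /\ b.+1 = q ^ n.
Proof.
move=> pr_q odd_q n0 h.
have q1 := prime_gt1 pr_q.
have qn1 : 1 < q ^ n by rewrite -(exp1n n) ltn_exp2r.
have m0 : 0 < 2 ^ m by rewrite expn_gt0.
have coS : coprime b b.+1 by rewrite coprimenS.
have dvd_qn : q ^ n %| b * b.+1 by rewrite h dvdn_mull.
have : q %| b * b.+1 by apply: dvdn_trans dvd_qn; rewrite dvdn_exp.
rewrite Euclid_dvdM // => /orP [q_b|q_bS].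
  have co : coprime (q ^ n) b.+1 by rewrite coprimeXl ?(coprime_dvdl q_b).
  move: dvd_qn; rewrite Gauss_dvdl // => /dvdnP [c hc].
  have hcb : c * b.+1 = 2 ^ m by nia.
  case odd_c: (odd c).
    have c1 : c = 1 by apply: (@odd_dvd_exp2 _ m); rewrite // -hcb dvdn_mulr.
    by left; rewrite c1 in hc hcb; lia.
  have : b.+1 = 1.
    apply: (@odd_dvd_exp2 _ m); last by rewrite -hcb dvdn_mull.
    by rewrite /= hc oddM odd_c.
  by nia.
have co : coprime (q ^ n) b.
  by rewrite coprimeXl // coprime_sym (coprime_dvdr q_bS).
move: dvd_qn; rewrite Gauss_dvdr // => /dvdnP [c hc].
have hcb : c * b = 2 ^ m by nia.
case odd_c: (odd c).
  have c1 : c = 1 by apply: (@odd_dvd_exp2 _ m); rewrite // -hcb dvdn_mulr.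
  by right; rewrite c1 in hc hcb; lia.
have b1 : b = 1.
  apply: (@odd_dvd_exp2 _ m); last by rewrite -hcb dvdn_mull.
  by have := oddM c (q ^ n); rewrite -hc odd_c /=; lia.
have c1 : c = 1 by nia.
by rewrite c1 in odd_c.
Qed.

Lemma consecutive_mul_exp2_safe_prime (p b m n : nat) :
  prime p -> odd p -> prime (2 * p + 1) -> 0 < n ->
  b * b.+1 = 2 ^ m * (2 * p + 1) ^ n ->
  [/\ n = 1, b = 2 * p + 1 & 2 * (p + 1) = 2 ^ m].
Proof.
move=> pr_p odd_p pr_q n0 h.
have p1 := prime_gt1 pr_p.
have odd_q : odd (2 * p + 1) by lia.
case: (consecutive_mul_exp2_prime _ _ _ _ pr_q odd_q n0 h) => [] [hb hbS].
  have n1 : n = 1.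
    by apply: (@exp_succ_eq_exp2 (2 * p + 1) n m); rewrite -?hb -?hbS; lia.
  by rewrite n1 expn1 in hb; split=> //; lia.
have n1 : n = 1.
  by apply: (@exp_eq_exp2_succ (2 * p + 1) n m); rewrite -?hb -?hbS; lia.
(* Here [2 * p = 2^m], so the odd number [p] divides a power of two. *)
have : p = 1.
  apply: (@odd_dvd_exp2 _ m) => //; rewrite -hb.
  by have -> : b = 2 * p; [move: hbS; rewrite n1 expn1; lia | rewrite dvdn_mull].
by lia.
Qed.

(** * Restrictions on the exponents *)

Lemma odd_of_mod8 (p : nat) : p %% 8 = 3 \/ p %% 8 = 5 -> odd p.
Proof. lia. Qed.

Lemma coprime_sophie_germain_base (p k : nat) :
  odd p -> coprime p (2 ^ (2 * k + 1) * (2 * p + 1)).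
Proof.
move=> odd_p; rewrite coprimeMr coprimeXr ?coprimen2 //=.
by rewrite /coprime gcdnMDl gcdn1.
Qed.

Lemma exponent_even (p k x y z : nat) :
  p %% 8 = 3 \/ p %% 8 = 5 -> 0 < x ->
  p ^ x + (2 ^ (2 * k + 1) * (2 * p + 1)) ^ y = z ^ 2 -> ~~ odd y.
Proof.
move=> hp8 x0 h; apply/negP => odd_y; have odd_p := odd_of_mod8 _ hp8.
have hz : z ^ 2 = 2 ^ ((2 * k + 1) * y) %[mod p].
  rewrite -h -(prednK x0) expnS [p * _]mulnC modnMDl expnMn -expnM.
  by rewrite -modnMmr -modnXm modnMDl modnXm exp1n modnMmr muln1.
have [e he] : exists e, (2 * k + 1) * y = e.*2.+1.
  by apply: odd_doubleS; rewrite oddM odd_y addn1 /= mul2n odd_double.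
(* [(p + 1) / 2] is the inverse of 2 modulo [p]. *)
have [d hd] := odd_doubleS _ odd_p; pose v := d.+1.
have hv : 2 * v = 1 %[mod p].
  have -> : 2 * v = 1 * p + 1 by rewrite /v hd; clear; lia.
  by rewrite modnMDl.
(* Modulo [p], [(z v^e)^2 = 2^(2e+1) v^(2e) = 2 (2v)^(2e) = 2]. *)
apply: (two_nonresidue p (z * v ^ e) hp8).
rewrite expnMn -modnMml hz modnMml he.
have -> : 2 ^ e.*2.+1 * (v ^ e) ^ 2 = 2 * (2 * v) ^ e.*2.
  by rewrite expnS expnMn -expnM muln2 mulnA.
by rewrite -modnMmr -modnXm hv modnXm exp1n modnMmr.
Qed.

(** Both [z - a] and [z + a] are powers of [p]; if [p] divided both it would divide [2a]. Hence
    [z - a = 1]. *)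
Lemma prime_power_add_sqr (p a x z : nat) :
  prime p -> odd p -> coprime p a -> 0 < a ->
  p ^ x + a ^ 2 = z ^ 2 -> p ^ x = 2 * a + 1 /\ z = a + 1.
Proof.
move=> pr_p odd_p co_pa a0 h.
have hmul : (z - a) * (z + a) = p ^ x by rewrite -subn_sqr -h addnK.
have px0 : 0 < p ^ x by rewrite expn_gt0 prime_gt0.
have lt_az : a < z by rewrite -subn_gt0; case: (z - a) hmul px0 => // <-.
have /(dvdn_pfactor _ _ pr_p) [i _ hi] : z - a %| p ^ x by rewrite -hmul dvdn_mulr.
have /(dvdn_pfactor _ _ pr_p) [j _ hj] : z + a %| p ^ x by rewrite -hmul dvdn_mull.
have j0 : 0 < j by case: j hj a0 lt_az => //; rewrite expn0; clear; lia.
suff i0 : i = 0.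
  by rewrite i0 expn0 in hi; move: hmul; rewrite hi mul1n => <-; lia.
case: i hi => // i hi; exfalso.
have : p %| 2 * a.
  have -> : 2 * a = (z + a) - (z - a) by lia.
  by rewrite hi hj dvdn_sub // dvdn_exp.
by rewrite Gauss_dvdl // dvdn_prime2 // => /eqP p2; rewrite p2 in odd_p.
Qed.

Lemma exp_mod8_even (p x : nat) :
  p %% 8 = 3 \/ p %% 8 = 5 -> p ^ x = 1 %[mod 8] -> ~~ odd x.
Proof.
move=> hp8 h; apply/negP => odd_x; move: h.
have [t ->] := odd_doubleS _ odd_x.
rewrite expnS -mul2n expnM -modnMmr -modnXm.
have -> : p ^ 2 %% 8 = 1 by rewrite -modnXm; case: hp8 => ->.
by rewrite exp1n modnMmr muln1; case: hp8 => ->.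
Qed.

Lemma dvd_of_exp_eq (p d c r : nat) : 0 < d -> p ^ d = c * p + r -> p %| r.
Proof. by move=> d0 h; rewrite -(dvdn_addr _ (dvdn_mull c (dvdnn p))) -h dvdn_exp. Qed.

Lemma exponent_zero (p k x j : nat) :
  prime p -> prime (2 * p + 1) -> p %% 8 = 3 \/ p %% 8 = 5 ->
  p ^ x = 2 * (2 ^ (2 * k + 1) * (2 * p + 1)) ^ j + 1 -> j = 0.
Proof.
move=> pr_p pr_q hp8; have odd_p := odd_of_mod8 _ hp8.
have p1 := prime_gt1 pr_p.
rewrite expnMn -expnM => h; case: (posnP j) => // j0; exfalso.
have M0 : 0 < (2 * k + 1) * j by rewrite muln_gt0 addn1.
case: (leqP ((2 * k + 1) * j) 1) => M1.
  (* The exceptional case, where the right side need not be 1 modulo 8: [p] divides 5, but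
     [8 * 5 + 5 = 45] is no power of 5. *)
  have [k0 j1] : k = 0 /\ j = 1 by move: M1 j0; clear; nia.
  have hx : p ^ x = 8 * p + 5 by rewrite h k0 j1 expn1; clear; lia.
  have x0 : 0 < x by case: x hx {h} => //; rewrite expn0; clear; lia.
  have := dvd_of_exp_eq _ _ _ _ x0 hx.
  rewrite dvdn_prime2 // => /eqP p5; move: hx; rewrite p5; clear.
  case: x => [|[|[|x]]] //; rewrite !expnS.
  by have : 0 < 5 ^ x; [rewrite expn_gt0 | lia].
have [m hm] : exists m, (2 * k + 1) * j = m.+2.
  by case: ((2 * k + 1) * j) M1 => [|[|m]] // _; exists m.
have [t ht] : exists t, x = t.*2.
  apply/even_doubleE/(exp_mod8_even _ _ hp8).
  rewrite h hm !expnS.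
  have -> : 2 * (2 * (2 * 2 ^ m) * (2 * p + 1) ^ j) + 1
     = (2 ^ m * (2 * p + 1) ^ j) * 8 + 1 by clear; lia.
  by rewrite modnMDl.
have [b hb] : exists b, p ^ t = b.*2.+1.
  by apply: odd_doubleS; rewrite oddX odd_p orbT.
have hbb : b * b.+1 = 2 ^ m.+1 * (2 * p + 1) ^ j.
  by move: h; rewrite ht -muln2 expnM hb hm -mulnn [2 ^ m.+2]expnS; clear; nia.
have [_ hbq _] := consecutive_mul_exp2_safe_prime _ _ _ _ pr_p odd_p pr_q j0 hbb.
(* Now [p] divides 3, but [4 * 3 + 3 = 15] is no power of 3. *)
have hx : p ^ t = 4 * p + 3 by rewrite hb hbq; clear; lia.
have t0 : 0 < t by case: t hx {ht hb} => //; rewrite expn0; clear; lia.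
have := dvd_of_exp_eq _ _ _ _ t0 hx.
rewrite dvdn_prime2 // => /eqP p3; move: hx; rewrite p3; clear.
case: t => [|[|[|t]]] //; rewrite !expnS.
by have : 0 < 3 ^ t; [rewrite expn_gt0 | lia].
Qed.

Lemma one_add_exp_square (p k y z : nat) :
  prime p -> prime (2 * p + 1) -> odd p -> 0 < y ->
  1 + (2 ^ (2 * k + 1) * (2 * p + 1)) ^ y = z ^ 2 ->
  [/\ p = 3, k = 2, y = 1 & z = 15].
Proof.
move=> pr_p pr_q odd_p y0; have p1 := prime_gt1 pr_p.
rewrite expnMn -expnM => h.
have M0 : 0 < (2 * k + 1) * y by rewrite muln_gt0 addn1.
have odd_qy : odd ((2 * p + 1) ^ y) by rewrite oddX oddD oddM orbT.
have odd_z : odd z.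
  by have := oddX z 2; rewrite /= -h oddD oddM oddX -[_ == 0]negbK -lt0n M0.
have [b hb] := odd_doubleS _ odd_z.
have h4 : 4 * (b * b.+1) = 2 ^ ((2 * k + 1) * y) * (2 * p + 1) ^ y.
  by move: h; rewrite hb -mulnn; clear; nia.
have [m hm] : exists m, (2 * k + 1) * y = m.+2.
  (* Exponent 1 would make the right side of [h4] twice an odd number. *)
  case: ((2 * k + 1) * y) M0 h4 => [|[|m]] // _; last by exists m.
  by rewrite expn1; move: odd_qy; clear; lia.
have hbb : b * b.+1 = 2 ^ m * (2 * p + 1) ^ y.
  by move: h4; rewrite hm !expnS; clear; lia.
have [y1 hbq] := consecutive_mul_exp2_safe_prime _ _ _ _ pr_p odd_p pr_q y0 hbb.
have [l hl] : exists l, k = l.+1.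
  by exists k.-1; rewrite prednK //; move: hm; rewrite y1; clear; lia.
(* So [p + 1 = (2^l)^2], and [p = (2^l - 1)(2^l + 1)] is prime only if [2^l - 1 = 1]. *)
have -> : m = (l * 2).+1 by move: hm; rewrite y1 hl; clear; lia.
rewrite expnS expnM => /eqP; rewrite eqn_pmul2l // => /eqP hpm.
have hfac : p = (2 ^ l - 1) * (2 ^ l + 1) by rewrite -subn_sqr -hpm addnK.
have := dvdn_mull (2 ^ l - 1) (dvdnn (2 ^ l + 1)); rewrite -hfac.
have u0 : 0 < 2 ^ l by rewrite expn_gt0.
case/(primeP pr_p).2/orP => /eqP hu; first by move: hu u0; clear; lia.
have u2 : 2 ^ l = 2 by move: hfac; rewrite hu; move: p1 hu u0; clear; nia.
have l1 : l = 1 by apply/eqP; rewrite -(eqn_exp2l l 1 (isT : 1 < 2)) u2.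
by move: hu; rewrite u2 => hp; split; rewrite // ?hl ?l1 // hb hbq -hp.
Qed.

Theorem theorem4p1 (p k : nat)
    (hp : sophie_germain p)
    (hp8 : p = 3 %[mod 8] \/ p = 5 %[mod 8])
    (x y z : nat) :
  p ^ x + (2 ^ (2 * k + 1) * (2 * p + 1)) ^ y = z ^ 2 <->
  (p, x, y, z) = (3, 1, 0, 2) \/ (p, k, x, y, z) = (3, 2, 0, 1, 15).
Proof.
case/andP: hp => pr_p pr_q.
split=> [h|]; last by case=> [] [] *; subst.
have odd_p := odd_of_mod8 _ hp8.
case odd_y: (odd y).
  case: (posnP x) => [x0|x0]; last first.
    by have := exponent_even _ _ _ _ _ hp8 x0 h; rewrite odd_y.
  have y0 : 0 < y by case: y odd_y {h}.
  rewrite x0 expn0 in h.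
  have [-> -> -> ->] := one_add_exp_square _ _ _ _ pr_p pr_q odd_p y0 h.
  by right; rewrite x0.
have [j hy] := even_doubleE _ (negbT odd_y).
have co := coprime_sophie_germain_base p k odd_p.
have [] : p ^ x = 2 * (2 ^ (2 * k + 1) * (2 * p + 1)) ^ j + 1
    /\ z = (2 ^ (2 * k + 1) * (2 * p + 1)) ^ j + 1.
  apply: prime_power_add_sqr; rewrite ?coprimeXr //.
    by rewrite expn_gt0 muln_gt0 expn_gt0 !addn1.
  by rewrite -expnM muln2 -hy.
move=> hx; have j0 := exponent_zero _ _ _ _ pr_p pr_q hp8 hx.
(* With [j = 0] what remains is [p^x = 3] and [z = 2]. *)
move: hx; rewrite hy j0 !expn0 => hx hz.
have x0 : 0 < x by case: x hx {h}.
have := dvd_of_exp_eq _ _ 0 3 x0 hx.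
rewrite dvdn_prime2 // => /eqP p3.
have x1 : x = 1 by apply/eqP; rewrite -(eqn_exp2l x 1 (isT : 1 < 3)) -{1}p3 hx.
by left; rewrite p3 x1 hz.
Qed.
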